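(* Let $H=(V,E)$ be a hypergraph of rank $r$ with $m$ hyperedges, each of size at least $2$. Then the algorithm TTSV1-Unord (described in the context) runs on $H$ in time $$\Theta\left(\sum_{e\in E} r\,|e|\binom{r-1}{r-|e|}\right).$$ Moreover, letting $\epsilon=\min\left\{\frac{\mathrm{Vol}(H)}{rm},\,1-\frac{\mathrm{Vol}(H)}{rm}\right\}$, this running time is at least $\Omega(r^2 m)$ and at most $O\left(\epsilon\, m\, r^{3/2}\,2^r\right)$.
   Context: A hypergraph $H=(V,E)$ is a finite set $V$ of $n$ vertices together with a set $E$ of $m$ hyperedges, each a subset of $V$. The rank of $H$ is $r=\max_{e\in E}|e|$; its volume is $\mathrm{Vol}(H)=\sum_{e\in E}|e|$; $E(v)$ is the set of hyperedges containing the vertex $v$. Each hyperedge $e$ carries a weight $w_e\in\mathbb{R}$. For a hyperedge $e$, $\beta(e)$ is the set of tuples $(i_1,\dots,i_r)\in e^r$ in which every vertex of $e$ occurs at least once, and $\kappa(e)$ is the set of multisets of size $r$ with support exactly $e$; thus $|\kappa(e)|=\binom{r-1}{r-|e|}$. The adjacency tensor $\mathcal{A}$ of $H$ is the order-$r$, $n$-dimensional tensor with $\mathcal{A}_{p_1\dots p_r}=w_e$ if $(p_1,\dots,p_r)\in\beta(e)$ for a hyperedge $e$, and $0$ otherwise. For $\mathbf{b}\in\mathbb{R}^n$, the tensor-times-same-vector operation TTSV1 is the vector $\mathcal{A}\mathbf{b}^{r-1}\in\mathbb{R}^n$ with entries $[\mathcal{A}\mathbf{b}^{r-1}]_{i_1}=\sum_{i_2,\dots,i_r=1}^n\mathcal{A}_{i_1\dots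 i_r}\prod_{k=2}^r\mathbf{b}_{i_k}$. For $e=\{v_1,\dots,v_k\}$, $u\in e$ and $x\in\kappa(e)$, let $\phi_1(x,u)=\binom{r-1}{m_x(v_1),\dots,m_x(u)-1,\dots,m_x(v_k)}$ (multinomial coefficient), where $m_x(w)$ is the multiplicity of $w$ in $x$. Algorithm TTSV1-Unord. Input: the rank-$r$ weighted hypergraph $(V,E,w)$ and a vector $\mathbf{b}$. Output: $\mathbf{s}=\mathcal{A}\mathbf{b}^{r-1}$. For each $v\in V$: set $c\gets 0$; for each $e\in E(v)$ and each $x\in\kappa(e)$, update $c\gets c+w_e\frac{\phi_1(x,v)}{\mathbf{b}_v}\prod_{u\in x}\mathbf{b}_u$ (product with multiplicity); then set $\mathbf{s}_v\gets c$. Cost model: each innermost update (for a triple $(v,e,x)$) costs $\Theta(r)$ time, and the running time is the total cost of these updates. Asymptotic constants are absolute.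
   Formalization: The stated upper bound fails for uniform hypergraphs (ε = 0, but the time is Θ(r²m)); it is replaced by O(max(ε m r^{3/2} 2^r, r²m)) for all H, which gives O(ε m r^{3/2} 2^r) whenever that quantity is at least r²m. *)

(* Defs.v *)
From HB Require Import structures.
From mathcomp Require Import all_boot all_order all_algebra.
From mathcomp Require Import all_classical all_reals all_analysis.

Set Implicit Arguments.
Unset Strict Implicit.
Unset Printing Implicit Defensive.

Import Order.TTheory GRing.Theory Num.Theory.
Local Open Scope ring_scope.

(* A hypergraph is given by its vertex type [V : finType] and its set of       *)
(* hyperedges [E : {set {set V}}]; so n = #|V| and m = #|E|.                  *)
Section Hypergraph.
Variables (V : finType) (E : {set {set V}}).
Local Open Scope nat_scope.

Definition rank : nat := \max_(e in E) #|e|.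

Definition vol : nat := \sum_(e in E) #|e|.

Definition incident (v : V) : {set {set V}} := [set e in E | v \in e].

(* A multiset of size [rank] is encoded by its multiplicity function; no      *)
(* multiplicity can exceed [rank], so that these functions form a finType.    *)
Definition mmset : finType := {ffun V -> 'I_rank.+1}.

Definition kappa (e : {set V}) : {set mmset} :=
  [set x : mmset | (\sum_u x u == rank) && ([set u | x u != 0 :> nat] == e)].

(* Multinomial coefficient: the division is exact when [x \in kappa e] and    *)
(* [u \in e].                                                                 *)
Definition phi1 (e : {set V}) (x : mmset) (u : V) : nat :=
  (rank.-1)`! %/ \prod_(v in e) (x v - (v == u))`!.

End Hypergraph.

Section TTSV1Unord.
Variables (R : realType) (V : finType) (E : {set {set V}}).
Variables (w : {set V} -> R) (b : V -> R).
Variable cost : V -> {set V} -> mmset E -> R.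

(* Programs act on a pair (value, clock).                                     *)

Definition ttsv1_update (v : V) (e : {set V}) (ct : R * R) (x : mmset E) :
    R * R :=
  (ct.1 + w e * ((phi1 e x v)%:R / b v) * \prod_u b u ^+ x u,
   ct.2 + cost v e x).

Definition ttsv1_edge (v : V) (ct : R * R) (e : {set V}) : R * R :=
  foldl (ttsv1_update v e) ct (enum (kappa E e)).

Definition ttsv1_vertex (st : {ffun V -> R} * R) (v : V) :
    {ffun V -> R} * R :=
  let ct := foldl (ttsv1_edge v) (0, st.2) (enum (incident E v)) in
  ([ffun u => if u == v then ct.1 else st.1 u], ct.2).

Definition ttsv1_unord : {ffun V -> R} * R :=
  foldl ttsv1_vertex ([ffun=> 0], 0) (enum V).

Definition ttsv1_unord_time : R := ttsv1_unord.2.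

(* Each innermost update costs Theta(rank), with constants [lo] and [hi].     *)
Definition update_cost_Theta (lo hi : R) : Prop :=
  forall v e x, e \in incident E v -> x \in kappa E e ->
    lo * (rank E)%:R <= cost v e x <= hi * (rank E)%:R.

End TTSV1Unord.

Section Bounds.
Variables (R : realType) (V : finType) (E : {set {set V}}).

Definition eps : R :=
  let a := (vol E)%:R / ((rank E)%:R * #|E|%:R) in Num.min a (1 - a).

Definition exact_bound : R :=
  \sum_(e in E)
    (rank E)%:R * #|e|%:R * 'C((rank E).-1, rank E - #|e|)%:R.

Definition lower_bound : R := (rank E)%:R ^+ 2 * #|E|%:R.

(* This can be smaller than [lower_bound]: it is 0 when every hyperedge has   *)
(* size [rank E], since then [eps = 0].                                       *)
Definition upper_bound : R :=
  eps * #|E|%:R * (rank E)%:R `^ (3 / 2) * 2 ^+ rank E.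

End Bounds.

(* Main.v *)
Require Import Defs.
From mathcomp Require Import all_boot all_order all_algebra.
From mathcomp Require Import all_classical all_reals all_analysis.
From mathcomp Require Import zify ring.
Import Order.TTheory GRing.Theory Num.Theory.
Local Open Scope ring_scope.

(** Each hyperedge [e] is visited once for each [v] in [e], and each visit makes
    [#|kappa e| = 'C(r - 1, r - |e|)] updates (compositions of [r] into [|e|]
    positive parts), which gives the exact order. For the upper bound,
    [n * 'C(n, k) ^ 2 <= 4 ^ n] bounds [r * 'C(r - 1, r - |e|)] both by
    [sqrt r * 2 ^ r] and, when [j = r - |e|] is positive, by
    [2 * j * 'C(r, j + 1) <= 2 * j * 2 ^ r / sqrt r]. Summing over [e] bounds the
    work by [Vol * sqrt r * 2 ^ r] and by
    [r ^ 2 * m + 2 * (r * m - Vol) * sqrt r * 2 ^ r], where [r ^ 2 * m] pays for the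
    hyperedges of full size. *)

(** * Counting compositions and estimating binomial coefficients *)

Section Counting.
Local Open Scope nat_scope.

(** Lowering every multiplicity on [e] by one gives a bijection with the [#|e|]-tuples of naturals
    of sum [n - #|e|]. *)
Lemma card_composition_ffun (V : finType) (e : {set V}) (n : nat) :
  0 < #|e| <= n ->
  #|[set x : {ffun V -> 'I_n.+1} | (\sum_u x u == n)
      && ([set u | x u != 0 :> nat] == e)]| = 'C(n.-1, n - #|e|).
Proof.
case/andP=> e_gt0 le_en; have /card_gt0P[u0 u0e] := e_gt0.
have lt_en i : i <= n - #|e| -> i.+1 < n.+1.
  by move=> le_i; rewrite ltnS; lia.
(* The inverse map. Since [e] is nonempty, [n - #|e| + 1 <= n], so [inord] never falls back on its
   default. *)
pose g (t : #|e|.-tuple 'I_(n - #|e|).+1) : {ffun V -> 'I_n.+1} :=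
  [ffun u => if u \in e then inord (tnth t (enum_rank_in u0e u)).+1 else ord0].
have gE t u : g t u = (if u \in e then (tnth t (enum_rank_in u0e u)).+1 else 0) :> nat.
  by rewrite ffunE; case: ifP => // ue; rewrite inordK ?lt_en // -ltnS.
have sumgE (F : V -> nat) : (forall u, u \notin e -> F u = 0) ->
    \sum_u F u = \sum_(i < #|e|) F (enum_val i).
  move=> F0; rewrite (bigID (mem e)) /= [X in _ + X]big1 // addn0.
  exact: big_enum_val.
transitivity #|g @: [set t : #|e|.-tuple 'I_(n - #|e|).+1 |
                      \sum_(i <- t) i == n - #|e|]|; last first.
  rewrite card_imset => [|t1 t2 eq_g].
    case: #|e| e_gt0 le_en => // m _ lt_mn; rewrite card_ord_partitions.
    by rewrite -bin_sub; [congr ('C(_, _))|]; lia.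
  apply: eq_from_tnth => i; apply/val_inj.
  have /(congr1 (fun x : {ffun V -> 'I_n.+1} => x (enum_val i) : nat)) := eq_g.
  by rewrite !gE enum_valP enum_valK_in => -[].
apply: eq_card => x; rewrite inE; apply/idP/imsetP => [/andP[/eqP sum_x /eqP supp_x]|].
  have x0 u : u \notin e -> x u = 0 :> nat.
    by rewrite -supp_x inE negbK => /eqP.
  have x_gt0 (i : 'I_#|e|) : 0 < x (enum_val i).
    have : enum_val i \in [set u | x u != 0 :> nat] by rewrite supp_x enum_valP.
    by rewrite inE lt0n.
  have sum_pred : \sum_(i < #|e|) (x (enum_val i)).-1 = n - #|e|.
    have : #|e| + \sum_(i < #|e|) (x (enum_val i)).-1 = n.
      transitivity (\sum_(i < #|e|) (1 + (x (enum_val i)).-1)).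
        by rewrite big_split /= sum_nat_const card_ord muln1.
      rewrite -[RHS]sum_x (sumgE _ x0).
      by apply: eq_bigr => i _ /=; rewrite add1n prednK.
    lia.
  have le_x (i : 'I_#|e|) : (x (enum_val i)).-1 < (n - #|e|).+1.
    by rewrite ltnS -sum_pred (bigD1 i) //= leq_addr.
  exists [tuple Ordinal (le_x i) | i < #|e|].
    by rewrite inE big_tuple; under eq_bigr do rewrite tnth_mktuple; rewrite sum_pred.
  apply/ffunP => u; apply/val_inj; rewrite /= gE.
  case: ifPn => [ue|/x0 //]; rewrite tnth_mktuple /= enum_rankK_in //.
  by rewrite prednK // -(enum_rankK_in u0e ue).
case=> t; rewrite inE big_tuple => /eqP sum_t ->; apply/andP; split.
  rewrite sumgE => [|u /negPf ue]; last by rewrite gE ue.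
  under eq_bigr do rewrite gE enum_valP enum_valK_in -add1n.
  by rewrite big_split /= sum_t sum1_card card_ord subnKC.
by apply/eqP/setP=> u; rewrite inE gE; case: ifP.
Qed.

(* Pascal's rule only doubles the maximal binomial coefficient of a row; the gain
   of [sqrt ((n + 1) / n)] needed by the induction comes from the odd rows, where
   ['C(2 m + 1, k) <= (2 m + 1) / (m + 1) * 'C(2 m, i)] for a suitable [i]. *)
Lemma bin_bounds_even_odd (m k : nat) :
  (m.*2.+1 * 'C(m.*2, k) ^ 2 <= 16 ^ m) /\
  (m.+1 ^ 2 * 'C(m.*2.+1, k) ^ 2 <= m.*2.+1 * 16 ^ m).
Proof.
elim: m k => [|m IHm] k.
  by case: k => [|[|k]].
have odd_step n j : (forall i, n.*2.+1 * 'C(n.*2, i) ^ 2 <= 16 ^ n) ->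
    n.+1 ^ 2 * 'C(n.*2.+1, j) ^ 2 <= n.*2.+1 * 16 ^ n.
  (* Absorption gives equality with factor [2 n + 1 - j] for [i = j], and with factor [j] for
     [i = j - 1]; one of the two factors is at least [n + 1]. *)
  move=> even_n; have [i le_i] : exists i, n.+1 * 'C(n.*2.+1, j) <= n.*2.+1 * 'C(n.*2, i).
    have [le_jn|] := leqP j n.
      exists j; rewrite -[n.*2 in X in _ <= X]/(n.*2.+1.-1) mul_bin_down.
      by rewrite leq_mul2r; apply/orP; right; lia.
    case: j => // j lt_nj; exists j; rewrite mul_bin_diag leq_mul2r.
    by apply/orP; right.
  rewrite -expnMn (leq_trans (leq_mul le_i le_i)) //.
  by rewrite mulnACA -mulnA leq_mul2l even_n orbT.
have even_step j : m.+1.*2.+1 * 'C(m.+1.*2, j) ^ 2 <= 16 ^ m.+1.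
  case: j => [|j].
    rewrite bin0 exp1n muln1 expnS -mul2n.
    by have := ltn_expl m (isT : 1 < 16); lia.
  rewrite doubleS binS.
  have [_] := IHm j; have [_] := IHm j.+1.
  set a := 'C(_, _); set b := 'C(_, _); rewrite [16 ^ m.+1]expnS.
  set p := 16 ^ m => Ha Hb.
  rewrite -(@leq_pmul2l (m.+1 ^ 2)) //.
  (* This is [(a + b) ^ 2 <= 2 * (a ^ 2 + b ^ 2)] combined with the odd-row bounds. *)
  have : m.+1 ^ 2 * (a + b) ^ 2 <= 4 * (m.*2.+1 * p).
    have := leq_add (leq_add Ha Ha) (leq_add Hb Hb).
    have := leq_mul (leqnn (m.+1 ^ 2)) (nat_Cauchy a b).
    by rewrite !sqrnD; nia.
  move/(leq_mul (leqnn (m.*2.+3))) => H.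
  apply: leq_trans (_ : m.*2.+3 * (4 * (m.*2.+1 * p)) <= _); first by nia.
  (* The two sides differ by exactly 1, so the induction closes with constant 1. *)
  have : m.*2.+3 * m.*2.+1 <= 4 * m.+1 ^ 2 by rewrite -mul2n; nia.
  move: (m.*2.+3) (m.*2.+1) (m.+1 ^ 2) => A B M /(leq_mul (leqnn (4 * p))); lia.
by split; [apply: even_step | apply: odd_step].
Qed.

Lemma bin_sqr_bound (n k : nat) : n * 'C(n, k) ^ 2 <= 4 ^ n.
Proof.
have [-> //|n_gt0] := posnP n.
have E16 m : 16 ^ m = 4 ^ m.*2 by rewrite -[16]/(4 ^ 2) -expnM mul2n.
rewrite -(odd_double_half n); case: (odd n); rewrite ?add0n ?add1n.
  set m := n./2; have [_ H] := bin_bounds_even_odd m k.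
  rewrite [4 ^ _]expnS -E16 -(@leq_pmul2l (m.+1 ^ 2)) //.
  have : m.*2.+1 * m.*2.+1 <= 4 * m.+1 ^ 2 by rewrite -mul2n; nia.
  have := leq_mul (leqnn m.*2.+1) H; move: ('C(_, _)) (16 ^ m) => a p; nia.
set m := n./2; have [H _] := bin_bounds_even_odd m k.
by rewrite -E16; apply: leq_trans H; rewrite leq_mul2r leqnSn orbT.
Qed.

(** Absorption turns the left side into [(j + 1) * 'C(r, j + 1)]. The factor [j = r - |e|] is what
    sums to [r * m - Vol]. *)
Lemma mul_bin_pred_le (r j : nat) : 0 < j -> r * 'C(r.-1, j) <= 2 * j * 'C(r, j.+1).
Proof.
by move=> j_gt0; rewrite mul_bin_diag leq_mul2r; apply/orP; right; lia.
Qed.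

(** Applied with [n = r - 1] and [i = |e| - 1]; the excluded case [i = 0], false for [n > 0],
    corresponds to hyperedges of size 1. *)
Lemma mulS_bin_ge (n i : nat) : 0 < i <= n -> n < i.+1 * 'C(n, i).
Proof.
elim: n i => [|n IHn] [|i] //=.
rewrite ltnS => le_in; have [->|ne_in] := eqVneq i n; first by rewrite binn muln1.
have := IHn i.+1; rewrite binS mulnDr => /(_ ltac:(lia)).
have : 0 < 'C(n, i) by rewrite bin_gt0.
nia.
Qed.

End Counting.

(** A step's cost depends on the list item but not on the state, so the lemma applies to each level
    of nested loops. *)
Lemma foldl_clock (R : nmodType) (A S : Type) (step : S -> A -> S) (clock : S -> R)
    (c : A -> R) (s : S) (l : seq A) :
  (forall st a, clock (step st a) = clock st + c a) ->
  clock (foldl step s l) = clock s + \sum_(a <- l) c a.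
Proof.
move=> clock_step; elim: l s => [|a l IHl] s /=; first by rewrite big_nil addr0.
by rewrite IHl clock_step big_cons addrA.
Qed.

Arguments foldl_clock {R A S step} clock c {s l}.

Lemma card_rank {V : finType} {E : {set {set V}}} {e : {set V}} :
  e \in E -> (#|e| <= rank E)%N.
Proof. by move=> eE; rewrite /rank (bigD1 e) //= leq_maxl. Qed.

(** * Exact running time and its lower bound *)

Section Time.
Variables (R : realType) (V : finType) (E : {set {set V}}).
Variables (w : {set V} -> R) (b : V -> R) (cost : V -> {set V} -> mmset E -> R).

Lemma ttsv1_unord_timeE :
  ttsv1_unord_time w b cost =
  \sum_(e in E) \sum_(v in e) \sum_(x in kappa E e) cost v e x.
Proof.
pose edge_cost v e := \sum_(x in kappa E e) cost v e x.
have edgeE v (ct : R * R) e :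
    (ttsv1_edge w b cost v ct e).2 = ct.2 + edge_cost v e.
  by rewrite /ttsv1_edge (foldl_clock snd (cost v e)) ?big_enum.
have vertexE st v : (ttsv1_vertex w b cost st v).2 =
    st.2 + \sum_(e in incident E v) edge_cost v e.
  by rewrite /ttsv1_vertex /= (foldl_clock snd (edge_cost v)) ?big_enum.
rewrite /ttsv1_unord_time /ttsv1_unord (foldl_clock snd _ vertexE) add0r big_enum.
(* Double counting of incidences: the loop over [e] in [E(v)] becomes one over [v] in [e]. *)
rewrite (exchange_big_dep (mem E)) /= => [|v e _]; last by rewrite inE => /andP[].
by apply: eq_bigr => e eE; apply: eq_bigl => v; rewrite inE eE.
Qed.

Hypothesis E_ge2 : forall e : {set V}, e \in E -> (2 <= #|e|)%N.

Lemma ttsv1_unord_time_bounds (lo hi : R) :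
  update_cost_Theta cost lo hi ->
  lo * exact_bound R E <= ttsv1_unord_time w b cost <= hi * exact_bound R E.
Proof.
move=> cost_bounds.
have exactE c : c * exact_bound R E =
    \sum_(e in E) \sum_(v in e) \sum_(x in kappa E e) c * (rank E)%:R.
  rewrite mulr_sumr; apply: eq_bigr => e eE.
  have e_bounds : (0 < #|e| <= rank E)%N by rewrite (card_rank eE) andbT ltnW ?E_ge2.
  rewrite !sumr_const /kappa card_composition_ffun //.
  by rewrite -mulrnA -[RHS]mulr_natr natrM; ring.
by rewrite !exactE ttsv1_unord_timeE; apply/andP; split;
  apply: ler_sum => e eE; apply: ler_sum => v ve; apply: ler_sum => x xe;
  have /andP[] := cost_bounds v e x ltac:(by rewrite inE eE) xe.
Qed.

Lemma lower_bound_le_exact : lower_bound R E <= exact_bound R E.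
Proof.
rewrite /lower_bound mulr_natr -sumr_const; apply: ler_sum => e eE.
rewrite expr2 -mulrA ler_wpM2l // -natrM ler_nat.
have := E_ge2 _ eE; have := card_rank eE; set r := rank E; set k := #|e| => le_kr k_ge2.
have := @mulS_bin_ge r.-1 k.-1 ltac:(lia).
rewrite -bin_sub; last by lia.
have -> : (r.-1 - k.-1 = r - k)%N by lia.
rewrite !prednK; lia.
Qed.

End Time.

(** Splitting [n] as [sqrt n * sqrt n] leaves [sqrt n * 'C(n, k) <= 2 ^ n], the square root of
    [bin_sqr_bound]. *)
Lemma mul_bin_sqrt_le (R : realType) (n k : nat) :
  (n * 'C(n, k))%:R <= Num.sqrt n%:R * 2 ^+ n :> R.
Proof.
rewrite natrM -{1}(@sqr_sqrtr R n%:R) // expr2 -mulrA ler_wpM2l ?sqrtr_ge0 //.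
rewrite -(@ler_pXn2r _ 2) // ?nnegrE ?mulr_ge0 ?sqrtr_ge0 ?exprn_ge0 //.
rewrite exprMn sqr_sqrtr // -!natrX -natrM ler_nat.
by rewrite -expnM [(_ * 2)%N]mulnC expnM bin_sqr_bound.
Qed.

(** * Upper bound in terms of [eps] *)

Section UpperBound.
Variables (R : realType) (V : finType) (E : {set {set V}}).
Hypothesis E_ge2 : forall e : {set V}, e \in E -> (2 <= #|e|)%N.
Local Notation r := (rank E).
Local Notation Q := (Num.sqrt r%:R * 2 ^+ r : R).

(** As [r ^ (3/2) = r * sqrt r], the factor [r * m], positive for nonempty [E], clears the
    denominators of [eps]. *)
Lemma upper_boundE : E != finset.set0 ->
  upper_bound R E = Num.min (vol E)%:R (r%:R * #|E|%:R - (vol E)%:R) * Q.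
Proof.
case/set0Pn=> e eE.
have r_gt0 : 0 < r%:R :> R.
  by rewrite ltr0n (leq_trans _ (card_rank eE)) // ltnW ?E_ge2.
have m_gt0 : 0 < #|E|%:R :> R by rewrite ltr0n card_gt0; apply/set0Pn; exists e.
have rm_gt0 : 0 < r%:R * #|E|%:R :> R by rewrite mulr_gt0.
have -> : upper_bound R E = eps R E * (r%:R * #|E|%:R) * Q.
  rewrite /upper_bound (_ : 3 / 2 = 1 + 2^-1); last by field.
  rewrite powRD; last by rewrite (gt_eqF r_gt0) implybT.
  by rewrite (powRr1 (ltW r_gt0)) (powR12_sqrt (ltW r_gt0)) !mulrA; congr (_ * _ * _); rewrite mulrAC.
rewrite /eps minr_pMl ?ltW //; congr (Num.min _ _ * _); field.
  by rewrite !gt_eqF.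
by rewrite !gt_eqF.
Qed.

Lemma exact_bound_le_vol : exact_bound R E <= (vol E)%:R * Q.
Proof.
rewrite /vol natr_sum mulr_suml; apply: ler_sum => e eE.
rewrite mulrAC [X in _ <= X]mulrC ler_wpM2r // -natrM.
apply: le_trans (mul_bin_sqrt_le _ _ (r - #|e|)); rewrite ler_nat leq_mul2l.
by rewrite leq_bin2l ?leq_pred ?orbT.
Qed.

Lemma exact_bound_le_covol : exact_bound R E <=
  lower_bound R E + 2 * (r%:R * #|E|%:R - (vol E)%:R) * Q.
Proof.
rewrite /vol natr_sum /lower_bound !mulr_natr -!sumr_const -sumrB.
rewrite mulr_sumr mulr_suml -big_split; apply: ler_sum => e eE /=.
(* A hyperedge of full size contributes exactly [r ^ 2]; for a smaller one the [r ^ 2] term is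
   slack. *)
have := card_rank eE; rewrite leq_eqVlt => /predU1P[->|lt_er].
  by rewrite subrr mulr0 mul0r addr0 subnn bin0 mulr1 expr2.
rewrite -natrB ?(ltnW lt_er) // ler_wpDl ?exprn_ge0 //.
set j := (r - #|e|)%N; have j_gt0 : (0 < j)%N by rewrite subn_gt0.
have lek : (#|e| * (r * 'C(r.-1, j)) <= r * (2 * j * 'C(r, j.+1)))%N.
  by rewrite leq_mul ?mul_bin_pred_le // ltnW.
rewrite -!natrM; apply: le_trans (_ : (r * (2 * j * 'C(r, j.+1)))%:R <= _).
  by rewrite ler_nat (leq_trans _ lek) // mulnAC mulnC mulnCA.
by rewrite mulnCA natrM ler_wpM2l // mul_bin_sqrt_le.
Qed.

Lemma exact_bound_le_max :
  exact_bound R E <= 3 * Num.max (upper_bound R E) (lower_bound R E).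
Proof.
have [->|E_neq0] := eqVneq E finset.set0.
  rewrite /exact_bound big_set0 mulr_ge0 // le_max; apply/orP; right.
  by rewrite /lower_bound cards0 mulr0.
have Q_ge0 : 0 <= Q by rewrite mulr_ge0 ?sqrtr_ge0 ?exprn_ge0.
have L_ge0 : 0 <= lower_bound R E by rewrite mulr_ge0 ?exprn_ge0.
(* Whichever argument attains the minimum in [upper_boundE] selects the estimate by [Vol] or by
   [r * m - Vol]. *)
have le_min : exact_bound R E <= lower_bound R E + 2 * upper_bound R E.
  have [vol_le covol_le] := conj exact_bound_le_vol exact_bound_le_covol.
  rewrite upper_boundE //; case: (leP (vol E)%:R) => _; last by rewrite mulrA.
  rewrite (le_trans vol_le) // ler_wpDl // ler_peMl ?mulr_ge0 //.
  by rewrite (ler_nat R 1 2).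
apply: le_trans le_min _; rewrite (_ : 3 = 1 + 2 :> R) ?mulrDl ?mul1r; last by ring.
by rewrite !lerD // le_max lexx ?orbT.
Qed.
End UpperBound.

Theorem proposition3p2 (R : realType) (lo hi : R) (lo_gt0 : 0 < lo)
    (hi_gt0 : 0 < hi) :
  exists c1 c2 c3 c4 : R,
    [/\ 0 < c1, 0 < c2, 0 < c3 & 0 < c4] /\
    forall (V : finType) (E : {set {set V}}) (w : {set V} -> R) (b : V -> R)
           (cost : V -> {set V} -> mmset E -> R),
      (forall e : {set V}, e \in E -> (2 <= #|e|)%N) ->
      update_cost_Theta cost lo hi ->
      let T := ttsv1_unord_time w b cost in
      [/\ c1 * exact_bound R E <= T <= c2 * exact_bound R E,
          c3 * lower_bound R E <= T,
          lower_bound R E <= upper_bound R E -> T <= c4 * upper_bound R E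
        & T <= c4 * Num.max (upper_bound R E) (lower_bound R E)].
Proof.
(* The factor 3 comes from [exact_bound_le_max]. *)
exists lo, hi, lo, (hi * 3); split; first by split=> //; rewrite mulr_gt0.
move=> V E w b cost E_ge2 cost_bounds T.
have T_bounds := ttsv1_unord_time_bounds R V E w b cost E_ge2 lo hi cost_bounds.
have /andP[T_ge T_le] := T_bounds.
have T_le_max : T <= hi * 3 * Num.max (upper_bound R E) (lower_bound R E).
  by rewrite (le_trans T_le) // -mulrA ler_wpM2l ?exact_bound_le_max // ltW.
split=> // [|/max_idPl max_eq]; last by rewrite -max_eq.
by apply: le_trans T_ge; rewrite ler_wpM2l ?lower_bound_le_exact // ltW.
Qed.
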